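(* Let $Z$ be a separable Banach space, let $Y=Z^*$, and let $A:\ell^1\to Y$ be a bounded linear operator which is injective and weak$^*$-to-weak$^*$ continuous. Let $\mu\in[0,1)$ and a real sequence $\{\gamma_n\}_{n\in\mathbb{N}}$ be such that for each $n\in\mathbb{N}$ and each $\xi\in\ell^\infty$ with $\xi_k\in[-1,1]$ for $k\le n$ and $\xi_k=0$ for $k>n$ there exists $\eta\in Y^*$ satisfying (a) $P_nA^*\eta=\xi$, (b) $|[(I-P_n)A^*\eta]_k|\le\mu$ for all $k>n$, (c) $\|\eta\|_{Y^*}\le\gamma_n$. Assume that the equation $Ax=y$ is well-posed, i.e. $\mathcal{R}(A)=\overline{\mathcal{R}(A)}^Y$. Let $p>1$, $x^\dagger\in\ell^1$ and $y=Ax^\dagger$. For noisy data $y^\delta\in Y$ with $\|y-y^\delta\|_Y\le\delta$, $\delta>0$, and $\alpha>0$ let $x_\alpha^\delta$ denote minimizers over $x\in\ell^1$ of $$\frac1p\|Ax-y^\delta\|_Y^p+\alpha\|x\|_{\ell^1}.$$ Then $$\|x_\alpha^\delta-x^\dagger\|_{\ell^1}=O(\delta)\quad\text{as }\delta\to0,$$ whenever the regularization parameter $\alpha>0$ is chosen either a priori as $\alpha=\alpha(\delta)\sim\delta^{p-1}$, or a posteriori as $\alpha=\alpha_{SDP}(\delta,y^\delta)$ according to the sequential discrepancy principle.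
   Context: All spaces are over the real numbers; $\mathbb{N}=\{1,2,\dots\}$. $\ell^1$ is the space of absolutely summable sequences, $\ell^\infty=(\ell^1)^*$, and $\ell^1=(c_0)^*$. $P_n$ is the projection $P_nx=(x_1,\dots,x_n,0,0,\dots)$ and $[v]_k$ denotes the $k$-th component of a sequence $v$. The weak$^*$ topology on $\ell^1$ is taken with respect to the predual $c_0$, and on $Y$ with respect to the predual $Z$. $A$ is weak$^*$-to-weak$^*$ continuous if $x_n\rightharpoonup^* x_0$ in $\ell^1$ implies $Ax_n\rightharpoonup^* Ax_0$ in $Y$ (sequences). $A^*:Y^*\to\ell^\infty$ is the Banach space adjoint of $A$; $\mathcal{R}(A)$ is the range of $A$. The notation $\alpha(\delta)\sim\delta^{p-1}$ means $c_1\delta^{p-1}\le\alpha(\delta)\le c_2\delta^{p-1}$ with constants $0<c_1\le c_2$ for all sufficiently small $\delta>0$. Sequential discrepancy principle: fix $\tau>1$, $0<q<1$ and $\alpha_0>0$, and let $\Delta_q=\{\alpha_j=q^j\alpha_0: j=1,2,\dots\}$. Given $\delta>0$ and $y^\delta$, the parameter $\alpha=\alpha_{SDP}(\delta,y^\delta)$ is chosen in $\Delta_q$ such that $\|Ax_\alpha^\delta-y^\delta\|_Y\le\tau\delta<\|Ax_{\alpha/q}^\delta-y^\delta\|_Y$; the assertion concerns parameters satisfying this. The $O$-statement means: there are constants $C,\overline\delta>0$ (independent of $\delta$ and $y^\delta$) such that the error is at most $C\delta$ for all $0<\delta\le\overline\delta$ and all $y^\delta$ with $\|y-y^\delta\|_Y\le\delta$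 and the parameter chosen as described. *)

(* Defs.v *)
From HB Require Import structures.
From mathcomp Require Import all_boot all_order all_algebra.
From mathcomp Require Import all_classical all_reals all_analysis.

Set Implicit Arguments.
Unset Strict Implicit.
Unset Printing Implicit Defensive.

Import Order.TTheory GRing.Theory Num.Theory.
Import numFieldNormedType.Exports.

Local Open Scope classical_set_scope.
Local Open Scope ring_scope.

Section BoundedOperators.
Context {R : realType} (V W : normedModType R).

Definition bounded_linear (f : V -> W) : Prop :=
  linear f /\ exists M : R, forall x, `|f x| <= M * `|x|.

Definition bop_pred : {pred V -> W} := fun f => `[< bounded_linear f >].

Record bop := Bop { bop_fun : V -> W; bop_funP : bop_fun \in bop_pred }.

HB.instance Definition _ := [isSub for bop_fun].
HB.instance Definition _ := [Choice of bop by <:].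

Fact bop_submod_closed : submod_closed bop_pred.
Proof.
split.
  apply/asboolP; split; last by exists 0 => x; rewrite normr0 mul0r.
  by move=> a u v /=; rewrite scaler0 addr0.
move=> a f g /asboolP[lf [M fM]] /asboolP[lg [N gN]].
apply/asboolP; split.
  move=> b u v; rewrite /= !fctE lf lg !scalerDr !scalerA addrACA.
  by rewrite (mulrC a b).
exists (`|a| * M + N) => x; rewrite fctE (le_trans (ler_normD _ _))//.
by rewrite mulrDl lerD// normrZ -mulrA ler_wpM2l.
Qed.
HB.instance Definition _ :=
  GRing.isSubmodClosed.Build _ _ bop_pred bop_submod_closed.
HB.instance Definition _ := [SubChoice_isSubLmodule of bop by <:].

Fact bop_linear (f : bop) : linear (bop_fun f).
Proof. by case: f => f /= /asboolP[]. Qed.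
HB.instance Definition _ (f : bop) :=
  GRing.isLinear.Build R V W _ (bop_fun f) (bop_linear f).

Fact bop_bounded (f : bop) : exists M : R, forall x, `|bop_fun f x| <= M * `|x|.
Proof. by case: f => f /= /asboolP[]. Qed.

Definition unit_values (f : bop) : set R :=
  [set `|bop_fun f x| | x in [set x : V | `|x| <= 1]].

Definition op_norm (f : bop) : R := sup (unit_values f).

Fact unit_values_has_sup (f : bop) : has_sup (unit_values f).
Proof.
split; first by exists `|bop_fun f 0|; exists 0 => //=; rewrite normr0.
have [M fM] := bop_bounded f; exists `|M| => _ [x /= x1 <-].
rewrite (le_trans (fM x))// (le_trans (ler_wpM2r _ (ler_norm M)))//.
by rewrite ler_piMr.
Qed.

Fact op_norm_ub (f : bop) (x : V) : `|x| <= 1 -> `|bop_fun f x| <= op_norm f.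
Proof.
by move=> x1; apply: sup_upper_bound; [exact: unit_values_has_sup|exists x].
Qed.

Fact op_norm_le (f : bop) (c : R) :
  (forall x : V, `|x| <= 1 -> `|bop_fun f x| <= c) -> op_norm f <= c.
Proof.
move=> fc; apply: ge_sup; first by case: (unit_values_has_sup f).
by move=> _ [x /= x1 <-]; exact: fc.
Qed.

Fact op_normD (f g : bop) : op_norm (f + g) <= op_norm f + op_norm g.
Proof.
apply: op_norm_le => x x1.
by rewrite (le_trans (ler_normD _ _))// lerD// op_norm_ub.
Qed.

Fact op_norm_ge0 (f : bop) : 0 <= op_norm f.
Proof. by rewrite (le_trans _ (@op_norm_ub f 0 _)) ?normr0. Qed.

Fact op_normZ (a : R) (f : bop) : op_norm (a *: f) = `|a| * op_norm f.
Proof.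
have le_Z b g : op_norm (b *: g) <= `|b| * op_norm g.
  by apply: op_norm_le => x x1; rewrite normrZ ler_wpM2l// op_norm_ub.
apply/eqP; rewrite eq_le le_Z /=.
have [->|a0] := eqVneq a 0; first by rewrite normr0 mul0r op_norm_ge0.
rewrite -ler_pdivlMl ?normr_gt0// -normfV.
by rewrite (le_trans _ (le_Z _ _))// scalerA mulVf// scale1r.
Qed.

Fact op_norm0_eq0 (f : bop) : op_norm f = 0 -> f = 0.
Proof.
move=> f0; apply: val_inj; apply/funext => x /=.
have [->|x0] := eqVneq x 0; first by rewrite linear0.
have nx0 : `|x| != 0 by rewrite normr_eq0.
have := @op_norm_ub f (`|x|^-1 *: x).
rewrite f0 normrZ normfV normr_id mulVf// => /(_ (lexx _)).
rewrite normr_le0 linearZ /= scaler_eq0 invr_eq0 (negbTE nx0) /=.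
by move/eqP.
Qed.

HB.instance Definition _ :=
  Lmodule_isNormed.Build R bop op_normD op_normZ op_norm0_eq0.

End BoundedOperators.

Coercion bop_fun : bop >-> Funclass.

Notation dual V := (bop V _^o).

Section Adjoint.
Context {R : realType} {V W : normedModType R}.

Fact adjoint_subproof (A : bop V W) (eta : dual W) :
  (eta \o A : V -> R^o) \in @bop_pred R V R^o.
Proof.
apply/asboolP; split; first by move=> a u v /=; rewrite !linearP.
have [M AM] := bop_bounded A; have [N etaN] := bop_bounded eta.
exists (`|N| * M) => x /=; rewrite (le_trans (etaN _))//.
rewrite (le_trans (ler_wpM2r _ (ler_norm N)))// -mulrA.
by rewrite ler_wpM2l.
Qed.

Definition adjoint (A : bop V W) (eta : dual W) : dual V :=
  Bop (adjoint_subproof A eta).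

End Adjoint.

Section L1.
Context (R : realType).

Definition l1_pred : {pred nat -> R} :=
  fun x => `[< cvgn [normed series x] >].

Record l1 := L1 { l1_seq : nat -> R; l1_seqP : l1_seq \in l1_pred }.

HB.instance Definition _ := [isSub for l1_seq].
HB.instance Definition _ := [Choice of l1 by <:].

Fact l1_normedD (x y : nat -> R) :
  cvgn [normed series x] -> cvgn [normed series y] ->
  cvgn [normed series (x + y)].
Proof.
move=> cx cy; apply: (@series_le_cvg R (fun k => `|(x + y) k|)
   ((fun k => `|x k|) + (fun k => `|y k|))) => //.
- by move=> n; rewrite fctE addr_ge0.
- by move=> n; rewrite !fctE ler_normD.
- exact: is_cvg_seriesD.
Qed.

Fact l1_normedZ (a : R) (x : nat -> R) :
  [normed series (a *: x)] = series (`|a| *: (fun k => `|x k| : R)).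
Proof.
by congr (series _); apply/funext => k; exact: normrM.
Qed.

Fact l1_submod_closed : submod_closed l1_pred.
Proof.
split.
  apply/asboolP; rewrite (_ : [normed series _] = (fun=> 0)).
    exact: is_cvg_cst.
  by apply/funext => n /=; rewrite /series /= big1// => i _; rewrite normr0.
move=> a x y /asboolP cx /asboolP cy; apply/asboolP; apply: l1_normedD => //.
by rewrite l1_normedZ; exact: is_cvg_seriesZ.
Qed.
HB.instance Definition _ :=
  GRing.isSubmodClosed.Build _ _ l1_pred l1_submod_closed.
HB.instance Definition _ := [SubChoice_isSubLmodule of l1 by <:].

Fact l1_cvg (x : l1) : cvgn [normed series (l1_seq x)].
Proof. by case: x => x /= /asboolP. Qed.

Definition l1_norm (x : l1) : R := limn [normed series (l1_seq x)].

Fact l1_normD (x y : l1) : l1_norm (x + y) <= l1_norm x + l1_norm y.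
Proof.
have cx := @l1_cvg x; have cy := @l1_cvg y.
rewrite /l1_norm -(lim_seriesD cx cy).
apply: lim_series_le; first exact: l1_cvg.
- exact: is_cvg_seriesD.
- by move=> n; rewrite !fctE ler_normD.
Qed.

Fact l1_normZ (a : R) (x : l1) : l1_norm (a *: x) = `|a| * l1_norm x.
Proof.
by rewrite /l1_norm l1_normedZ lim_seriesZ//; exact: l1_cvg.
Qed.

Fact l1_norm0_eq0 (x : l1) : l1_norm x = 0 -> x = 0.
Proof.
move=> x0; apply: val_inj; apply/funext => k /=.
apply/eqP; rewrite -normr_le0 -x0.
have nd : nondecreasing_seq [normed series (l1_seq x)].
  by apply/nondecreasing_seqP => n; rewrite /= seriesSr lerDl.
rewrite (le_trans _ (nondecreasing_cvgn_le nd (@l1_cvg x) k.+1))//.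
by rewrite /= seriesSr lerDr /series /= sumr_ge0.
Qed.

HB.instance Definition _ :=
  Lmodule_isNormed.Build R l1 l1_normD l1_normZ l1_norm0_eq0.

Fact l1_unit_subproof (k : nat) :
  (fun i => (i == k)%:R : R) \in l1_pred.
Proof.
apply/asboolP; apply: (@cvgP _ _ (1 : R)).
apply: (@cvg_near_cst _ _ _ _ _); near=> n.
have kn : (k < n)%N by near: n; exact: nbhs_infty_gt.
rewrite /= /series /= (bigD1_seq k) ?mem_index_iota ?iota_uniq//= eqxx normr1.
by rewrite big1 ?addr0// => i /negbTE ->; rewrite normr0.
Unshelve. all: by end_near. Qed.

Definition l1_unit (k : nat) : l1 := L1 (l1_unit_subproof k).

End L1.

Coercion l1_seq : l1 >-> Funclass.

(* The identification (l^1)^* = l^oo: a functional f corresponds to the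
   bounded sequence of its values on the unit vectors. *)
Definition dual_l1_seq {R : realType} (f : dual (l1 R)) : nat -> R :=
  fun k => f (l1_unit R k).

(* Sequences are indexed from 0, so the first n components are those with
   index k < n. *)
Definition seq_proj {R : realType} (n : nat) (v : nat -> R) : nat -> R :=
  fun k => if (k < n)%N then v k else 0.

Definition c0 {R : realType} : set (nat -> R) :=
  [set z | z n @[n --> \oo] --> (0 : R)].

Definition l1_wstar_cvg {R : realType} (x : nat -> l1 R) (x0 : l1 R) : Prop :=
  forall z : nat -> R, c0 z ->
    limn (series (fun k => x n k * z k)) @[n --> \oo]
      --> limn (series (fun k => x0 k * z k)).

Definition dual_wstar_cvg {R : realType} {Z : normedModType R}
    (f : nat -> dual Z) (f0 : dual Z) : Prop :=
  forall z : Z, f n z @[n --> \oo] --> f0 z.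

Definition wstar_continuous {R : realType} {Z : normedModType R}
    (A : bop (l1 R) (dual Z)) : Prop :=
  forall (x : nat -> l1 R) (x0 : l1 R),
    l1_wstar_cvg x x0 -> dual_wstar_cvg (A \o x) (A x0).

Definition separable_space (T : topologicalType) : Prop :=
  exists D : set T, countable D /\ dense D.

Section Tikhonov.
Context {R : realType} {Y : normedModType R} (A : bop (l1 R) Y) (p : R).

Definition tikhonov (alpha : R) (yd : Y) (x : l1 R) : R :=
  p^-1 * `|A x - yd| `^ p + alpha * `|x|.

Definition is_minimizer (alpha : R) (yd : Y) (x : l1 R) : Prop :=
  forall u : l1 R, tikhonov alpha yd x <= tikhonov alpha yd u.

End Tikhonov.

Definition a_priori_choice {R : realType} (p : R) (alpha : R -> R) : Prop :=
  (forall delta, 0 < delta -> 0 < alpha delta) /\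
  exists c1 c2 : R, 0 < c1 /\ c1 <= c2 /\
    \forall delta \near 0^'+,
      c1 * delta `^ (p - 1) <= alpha delta <= c2 * delta `^ (p - 1).

Definition SDP_grid {R : realType} (q alpha0 : R) : set R :=
  [set q ^+ j * alpha0 | j in [set j | (1 <= j)%N]].

(* Minimizers need not be unique; x plays the role of the minimizer for alpha
   and x' that of the minimizer for alpha / q. *)
Definition SDP_choice {R : realType} {Y : normedModType R}
    (A : bop (l1 R) Y) (p tau q alpha0 delta : R) (yd : Y)
    (alpha : R) (x : l1 R) : Prop :=
  SDP_grid q alpha0 alpha /\ is_minimizer A p alpha yd x /\
  exists x' : l1 R, is_minimizer A p (alpha / q) yd x' /\
    `|A x - yd| <= tau * delta /\ tau * delta < `|A x' - yd|.

(* Main.v *)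
(** The statement reduces to the lower bound [|x| <= c |A x|].  Testing
    (a)-(c) with the signs of the first [n] components of [x] gives
    [|P_n x| <= mu |x - P_n x| + gamma_n |A x|].  If [A] were not bounded below,
    one could build a sequence [S_N] in l^1 with [|S_N| >= N], while [A S_N]
    converges so fast that [gamma_n |A S_N - w| <= 1], [w] being the limit and
    [n] being so large that the tail of [S_N] beyond [n] has norm at most 1.
    As the range is closed, [w = A x], and the estimate applied to [x - S_N]
    bounds [|S_N|] in terms of [|x|] only, a contradiction.
    Given the lower bound, the discrepancy principle yields the rate at once,
    and the a priori choice yields it by comparing the Tikhonov functional at
    the minimizer and at the exact solution. *)

Require Import Defs.
From HB Require Import structures.
From mathcomp Require Import all_boot all_order all_algebra.
From mathcomp Require Import all_classical all_reals all_analysis.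
From mathcomp Require Import ring lra.

Set Implicit Arguments.
Unset Strict Implicit.
Unset Printing Implicit Defensive.

Import Order.TTheory GRing.Theory Num.Theory.
Import numFieldNormedType.Exports.
Local Open Scope classical_set_scope.
Local Open Scope ring_scope.

(** * Operator norm estimates and completeness of the dual *)

Lemma bop_norm_le (R : realType) (V W : normedModType R) (f : bop V W) (x : V) :
  `|f x| <= `|f| * `|x|.
Proof.
have [->|x0] := eqVneq x 0; first by rewrite linear0 !normr0 mulr0.
have nx0 : 0 < `|x| by rewrite normr_gt0.
have := @op_norm_ub R V W f (`|x|^-1 *: x).
rewrite normrZ normfV normr_id mulVf ?gt_eqF// => /(_ (lexx _)).
by rewrite linearZ /= normrZ normfV normr_id ler_pdivrMl// mulrC.
Qed.

Lemma bopB (R : realType) (V W : normedModType R) (f g : bop V W) (x : V) :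
  (f - g) x = f x - g x.
Proof. by []. Qed.

Section DualComplete.
Context {R : realType} {Z : normedModType R}.

(** The limit is taken pointwise, and the estimate at each [z] passes to it. The explicit rate [e]
    is kept because the distance to the limit must later outweigh the factor [gamma n]. *)
Lemma dual_complete (f : nat -> dual Z) (e : nat -> R) :
  e @ \oo --> (0 : R) ->
  (forall n m, (n <= m)%N -> `|f m - f n| <= e n) ->
  exists g : dual Z, forall n, `|g - f n| <= e n.
Proof.
move=> e0 fe.
have fz z n m : (n <= m)%N -> `|(f m z : R) - f n z| <= e n * `|z|.
  move=> nm; apply: le_trans (ler_wpM2r (normr_ge0 z) (fe _ _ nm)).
  by have := bop_norm_le (f m - f n) z; rewrite bopB.
have cf z : cvgn (fun n => f n z : R).
  apply/cauchy_cvgP; apply: cauchy_exP => eps eps0.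
  have ez0 : (fun n => e n * `|z|) @ \oo --> (0 : R).
    by rewrite -(mul0r `|z|); exact: cvgMr_tmp.
  have /cvgrPdist_lt/(_ _ eps0)[N _ hN] := ez0.
  exists (f N z); exists N => // m /= Nm.
  rewrite /ball /= distrC (le_lt_trans (fz z _ _ Nm))//.
  have := hN N (leqnn _); rewrite sub0r normrN.
  exact: le_lt_trans (ler_norm _).
pose g z : R := limn (fun n => f n z : R).
have gf n z : `|g z - f n z| <= e n * `|z|.
  have h : (fun m => `|(f m z : R) - f n z|) @ \oo --> `|g z - f n z|.
    by apply: cvg_norm; apply: cvgB; [exact: cf|exact: cvg_cst].
  rewrite -(cvg_lim _ h)//; apply: limr_le; first exact: (cvgP _ h).
  by exists n => // m /= nm; exact: fz.
have gb : (g : Z -> R^o) \in @bop_pred R Z R^o.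
  apply/asboolP; split.
    move=> a u v; rewrite /g.
    rewrite (_ : (fun n => _) = (fun n => a * (f n u : R) + (f n v : R))).
      apply: cvg_lim => //; apply: cvgD; last exact: cf.
      by apply: cvgM; [exact: cvg_cst|exact: cf].
    by apply/funext => n; rewrite linearP.
  exists (e 0%N + `|f 0%N|) => z; rewrite mulrDl.
  rewrite -(subrK (f 0%N z : R) (g z)) (le_trans (ler_normD _ _))//.
  by rewrite lerD ?gf ?bop_norm_le.
exists (Bop gb) => n; apply: op_norm_le => z z1.
(* Here [0 <= e n] follows from the hypothesis with [m = n]. *)
apply: le_trans (gf n z) _; rewrite ler_piMr//.
exact: le_trans (fe n n _).
Qed.

End DualComplete.

(** * Truncations, tails and functionals on l^1 *)

Section L1Truncation.
Context {R : realType}.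
Implicit Types (x y : l1 R) (n m k : nat).

(** The projection P_n, written as a finite combination of unit vectors so that linearity alone
    evaluates functionals on it. *)
Definition l1_trunc n x : l1 R := \sum_(k < n) x k *: l1_unit R k.

Definition l1_psum n x : R := \sum_(k < n) `|x k|.

Lemma l1_seqD x y k : (x + y) k = x k + y k. Proof. by []. Qed.

Lemma l1_seqB x y k : (x - y) k = x k - y k. Proof. by []. Qed.

Lemma l1_seqZ (a : R) x k : (a *: x) k = a * x k. Proof. by []. Qed.

Lemma l1_truncE n x k : l1_trunc n x k = if (k < n)%N then x k else 0.
Proof.
rewrite /l1_trunc; elim: n => [|n IH]; first by rewrite big_ord0.
rewrite big_ord_recr l1_seqD IH ltnS.
rewrite l1_seqZ /l1_unit /=.
by have [kn|kn|->] := ltngtP k n; rewrite ?mulr0 ?addr0 ?mulr1 ?add0r.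
Qed.

Lemma l1_truncB n x y : l1_trunc n (x - y) = l1_trunc n x - l1_trunc n y.
Proof.
rewrite /l1_trunc -sumrB; apply: eq_bigr => k _.
by rewrite -scalerBl.
Qed.

Lemma cvg_l1_psum x : (fun n => l1_psum n x) @ \oo --> `|x|.
Proof.
rewrite (_ : (fun n => _) = [normed series x]); first exact: l1_cvg.
by apply/funext => n; rewrite /l1_psum /= /series /= big_mkord.
Qed.

Arguments cvg_l1_psum : clear implicits.

Lemma l1_psum_le n x : l1_psum n x <= `|x|.
Proof.
rewrite -(cvg_lim _ (cvg_l1_psum x))//.
apply: (@nondecreasing_cvgn_le _ (fun n => l1_psum n x)).
  by apply/nondecreasing_seqP => m; rewrite /l1_psum big_ord_recr lerDl.
exact: (cvgP _ (cvg_l1_psum x)).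
Qed.

Lemma l1_psumD n x y : l1_psum n (x + y) <= l1_psum n x + l1_psum n y.
Proof.
by rewrite /l1_psum -big_split; apply: ler_sum => k _; exact: ler_normD.
Qed.

Lemma l1_psum_cat n m x :
  l1_psum (n + m) x = l1_psum n x + \sum_(k < m) `|x (n + k)%N|.
Proof. exact: big_split_ord. Qed.

(** The l^1 norm is additive over disjoint supports: from index [n] on, the partial sums of the tail
    are those of [x] minus [l1_psum n x]. *)
Lemma l1_norm_tail n x : `|x - l1_trunc n x| = `|x| - l1_psum n x.
Proof.
rewrite -(cvg_lim _ (cvg_l1_psum (x - l1_trunc n x)))//; apply: cvg_lim => //.
apply: cvg_trans (cvgB (cvg_l1_psum x) (cvg_cst (l1_psum n x))).
apply: near_eq_cvg; near=> m.
have nm : (n <= m)%N by near: m; exact: nbhs_infty_ge.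
rewrite fctE -(subnKC nm) !l1_psum_cat addrAC subrr add0r.
rewrite [X in _ = X + _]big1 ?add0r => [|i _]; last first.
  by rewrite l1_seqB l1_truncE ltn_ord subrr normr0.
by apply: eq_bigr => i _; rewrite l1_seqB l1_truncE ltnNge leq_addr subr0.
Unshelve. all: by end_near. Qed.

Lemma l1_norm_tail_le n x : `|x - l1_trunc n x| <= `|x|.
Proof. by rewrite l1_norm_tail gerBl; apply: sumr_ge0. Qed.

Lemma cvg_l1_tail x : (fun n => `|x - l1_trunc n x|) @ \oo --> (0 : R).
Proof.
rewrite (_ : (fun n => _) = (fun n => `|x| - l1_psum n x)); last first.
  by apply/funext => n; exact: l1_norm_tail.
by rewrite -(subrr `|x|); apply: cvgB; [exact: cvg_cst|exact: cvg_l1_psum].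
Qed.

Arguments cvg_l1_tail : clear implicits.

Lemma l1_tail_small x (e : R) : 0 < e ->
  exists n, (1 <= n)%N /\ `|x - l1_trunc n x| <= e.
Proof.
move=> e0; have /cvgrPdist_le/(_ _ e0)[N _ hN] := cvg_l1_tail x.
exists N.+1; split=> //.
by have := hN N.+1 (leqnSn _); rewrite sub0r normrN normr_id.
Qed.

Lemma dual_l1_trunc (f : dual (l1 R)) n x :
  f (l1_trunc n x) = \sum_(k < n) x k * dual_l1_seq f k.
Proof.
by rewrite /l1_trunc linear_sum; apply: eq_bigr => k _; rewrite linearZ.
Qed.

(** On truncations of the tail [t] this is a finite sum whose first [n] terms vanish; continuity of
    [f] and density of the truncations carry it over to [t]. *)
Lemma dual_l1_tail_le (f : dual (l1 R)) (mu : R) n x : 0 <= mu ->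
  (forall k, (n <= k)%N -> `|dual_l1_seq f k| <= mu) ->
  `|f (x - l1_trunc n x)| <= mu * `|x - l1_trunc n x|.
Proof.
move=> mu0 fmu; set t := x - _.
have tr m : `|f (l1_trunc m t)| <= mu * `|t|.
  rewrite dual_l1_trunc (le_trans (ler_norm_sum _ _ _))//.
  apply: le_trans (ler_wpM2l mu0 (l1_psum_le m t)).
  rewrite /l1_psum mulr_sumr; apply: ler_sum => k _.
  rewrite normrM mulrC.
  have [kn|kn] := ltnP k n; last by rewrite ler_wpM2r ?fmu.
  by rewrite /t l1_seqB l1_truncE kn subrr normr0 !mulr0.
apply/ler_addgt0Pr => e e0.
(* The [+ 1] keeps the denominator positive even for [f = 0]; what is cut off from [t] then
   contributes at most [e]. *)
have d0 : 0 < e / (`|f| + 1) by rewrite divr_gt0// ltr_wpDl.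
have [m [_ hm]] := l1_tail_small t d0.
rewrite -{1}(subrK (l1_trunc m t) t) linearD (le_trans (ler_normD _ _))//.
rewrite [leRHS]addrC lerD ?tr// (le_trans (bop_norm_le _ _))//.
rewrite (le_trans (ler_wpM2l (normr_ge0 f) hm))//.
by rewrite mulrCA ger_pMr// ler_pdivrMr ?ltr_wpDl// mul1r lerDl.
Qed.

End L1Truncation.

(** * The lower bound for [A] *)

Section BoundedBelow.
Context {R : realType}.

Lemma l1_psum_source (W : normedModType R) (A : bop (l1 R) W)
    (mu gamma : R) (n : nat) (x : l1 R) : 0 <= mu ->
  (forall xi : nat -> R, bounded_fun xi ->
     (forall k, (k < n)%N -> -1 <= xi k <= 1) ->
     (forall k, (n <= k)%N -> xi k = 0) ->
     exists eta : dual W,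
       [/\ seq_proj n (dual_l1_seq (adjoint A eta)) = xi,
           (forall k, (n <= k)%N ->
              `|(dual_l1_seq (adjoint A eta)
                 - seq_proj n (dual_l1_seq (adjoint A eta))) k| <= mu)
         & `|eta| <= gamma]) ->
  l1_psum n x <= mu * `|x - l1_trunc n x| + gamma * `|A x|.
Proof.
move=> mu0 /(_ (fun k => if (k < n)%N then Num.sg (x k) else 0)) [||k|eta].
- exists 1; split; first exact: num_real.
  move=> M M1 k _ /=; case: ifP => _; rewrite ?normr0 ?normr_sg.
    by case: eqP => _ /=; lra.
  lra.
- by move=> k ->; rewrite -ler_norml normr_sg; case: (_ == _).
- by rewrite leqNgt => /negbTE ->.
move=> [etaE etamu etag]; pose f := adjoint A eta.
have fE k : (k < n)%N -> dual_l1_seq f k = Num.sg (x k).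
  by move=> kn; have := congr1 (@^~ k) etaE; rewrite /seq_proj /= kn.
have fmu k : (n <= k)%N -> `|dual_l1_seq f k| <= mu.
  move=> nk; have : `|dual_l1_seq f k - seq_proj n (dual_l1_seq f) k| <= mu.
    exact: etamu.
  by rewrite /seq_proj ltnNge nk subr0.
have fp : f (l1_trunc n x) = l1_psum n x.
  rewrite dual_l1_trunc; apply: eq_bigr => k _.
  by rewrite fE// mulrC normrEsg.
(* Here [f x] is [eta (A x)], controlled by (c), and the value on the tail is controlled by (b). *)
have fx : l1_psum n x = (f x : R) - f (x - l1_trunc n x).
  by rewrite -fp linearB /= opprB addrC subrK.
rewrite fx (le_trans (ler_norm _))// (le_trans (ler_normB _ _))// addrC.
rewrite lerD ?dual_l1_tail_le// (le_trans (bop_norm_le eta (A x)))//.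
by rewrite ler_wpM2r.
Qed.

Lemma l1_bounded_below (Z : normedModType R) (A : bop (l1 R) (dual Z))
    (mu : R) (gamma : nat -> R) : 0 <= mu ->
  range A = closure (range A) ->
  (forall n x, (1 <= n)%N ->
     l1_psum n x <= mu * `|x - l1_trunc n x| + gamma n * `|A x|) ->
  exists2 c : R, 0 < c & forall x, `|x| <= c * `|A x|.
Proof.
move=> mu0 Acl Apsum; apply: contrapT => nbb.
(* A vector violating the bound with constant [(|M| + 1) / e] is rescaled to norm [|M| + 1]. *)
have small (M e : R) : 0 < e -> exists x, M <= `|x| /\ `|A x| <= e.
  move=> e0; apply: contrapT => nx; apply: nbb.
  exists ((`|M| + 1) / e); first by rewrite divr_gt0// ltr_wpDl.
  move=> x; rewrite leNgt; apply/negP => hx; apply: nx.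
  have x0 : 0 < `|x|.
    by apply: le_lt_trans hx; rewrite mulr_ge0// divr_ge0 ?ltW// ltr_wpDl.
  exists (((`|M| + 1) / `|x|) *: x).
  have M1 : 0 <= `|M| + 1 by rewrite addr_ge0.
  rewrite linearZ /= !normrZ normfV normr_id (ger0_norm M1).
  rewrite divfK ?gt_eqF//; split; first by rewrite ler_wpDr// ler_norm.
  rewrite mulrAC ler_pdivrMr// ltW//.
  by move: hx; rewrite mulrAC ltr_pdivrMr// mulrC [e * _]mulrC.
have /choice[nn nnP] : forall S : l1 R, exists n,
    (1 <= n)%N /\ `|S - l1_trunc n S| <= 1.
  by move=> S; exact: l1_tail_small.
(* A state pairs the current vector with its tolerance. Adding a vector of norm at least [2 |S| + 1]
   and small image raises the norm by at least 1. *)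
have /choice[nxt nxtP] : forall s : l1 R * R, exists S' : l1 R,
    0 < s.2 -> `|s.1| + 1 <= `|S'| /\ `|A S' - A s.1| <= s.2 / 2.
  move=> [S e] /=; have [e0|e0] := pselect (0 < e); last by exists 0.
  have e20 : 0 < e / 2 by rewrite divr_gt0.
  have [x [xM xe]] := small (`|S| + 1 + `|S|) (e / 2) e20.
  exists (x + S) => _; split; last by rewrite linearD addrK.
  have := ler_normB (x + S) S; rewrite addrK; lra.
(* The new tolerance is at most half the old one, and small against [gamma] at the cutoff index of
   the new vector. *)
pose step (s : l1 R * R) :=
  (nxt s, Num.min (s.2 / 2) (1 + `|gamma (nn (nxt s))|)^-1).
pose sq N := iter N step (0, (1 + `|gamma (nn 0)|)^-1).
pose S N := (sq N).1; pose e N := (sq N).2.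
have g0 n : 0 < (1 + `|gamma n|)^-1 by rewrite invr_gt0 ltr_pwDl.
have e0 N : 0 < e N.
  elim: N => [|N IH]; first exact: g0.
  by rewrite /e /sq iterS /= lt_min g0 divr_gt0.
have eg N : e N <= (1 + `|gamma (nn (S N))|)^-1.
  by case: N => [|N]; [exact: lexx|rewrite /e /sq iterS /= ge_min lexx orbT].
have eS N : e N.+1 <= e N / 2 by rewrite /e /sq iterS /= ge_min lexx.
have SS N : `|S N| + 1 <= `|S N.+1| /\ `|A (S N.+1) - A (S N)| <= e N / 2.
  exact: nxtP (sq N) (e0 N).
clearbody S e => {sq step nxtP nxt}.
have SN N : N%:R <= `|S N|.
  elim: N => [|N IH]; first by [].
  have [+ _] := SS N; rewrite -natr1; lra.
(* Since [e m / 2 <= e m - e m.+1], the increments telescope. *)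
have AS n m : (n <= m)%N -> `|A (S m) - A (S n)| <= e n - e m.
  elim: m => [|m IH]; first by rewrite leqn0 => /eqP ->; rewrite !subrr normr0.
  rewrite leq_eqVlt => /predU1P[->|]; first by rewrite !subrr normr0.
  rewrite ltnS => /IH {}IH; have [_ h] := SS m; have h' := eS m.
  apply: le_trans (ler_distD (A (S m)) _ _) _.
  apply: le_trans (lerD h IH) _; lra.
have e_cvg : e @ \oo --> (0 : R).
  have e2 N : e N <= e 0%N * 2^-1 ^+ N.
    elim: N => [|N IH]; first by rewrite expr0 mulr1.
    by rewrite (le_trans (eS N))// exprSr mulrA ler_wpM2r// invr_ge0.
  apply: (@squeeze_cvgr _ _ _ _ (fun=> 0) (fun N => e 0%N * 2^-1 ^+ N)).
  - by apply: nearW => N; rewrite ltW//= e2.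
  - exact: cvg_cst.
  - rewrite -(mulr0 (e 0%N)); apply: cvgM; first exact: cvg_cst.
    by apply: cvg_expr; rewrite ger0_norm ?invr_ge0// invf_lt1// ltr1n.
have [w wA] : exists w : dual Z, forall n, `|w - A (S n)| <= e n.
  apply: dual_complete e_cvg _ => n m nm; apply: le_trans (AS _ _ nm) _.
  by rewrite gerBl ltW.
have [x _ Ax] : range A w.
  rewrite Acl => B /nbhs_ballP[r /= r0 rB].
  have /cvgrPdist_lt/(_ _ r0)[N _ hN] := e_cvg.
  exists (A (S N)); split; first by exists (S N).
  apply: rB; rewrite -ball_normE /= (le_lt_trans (wA N))//.
  have := hN N (leqnn _); rewrite sub0r normrN.
  exact: le_lt_trans (ler_norm _).
(* The norm of [S N] splits at [n] into head and tail. The tail gives 1; the head is at most that of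
   [S N - x], bounded by [mu * (|x| + 1) + 1], plus that of [x]. *)
have Sbd N : `|S N| <= mu * (`|x| + 1) + `|x| + 2.
  set n := nn (S N); have [n1 tS] := nnP (S N); rewrite -/n in n1 tS.
  have := Apsum n (S N - x) n1.
  have tl : `|(S N - x) - l1_trunc n (S N - x)| <= `|x| + 1.
    have -> : (S N - x) - l1_trunc n (S N - x) =
        (S N - l1_trunc n (S N)) - (x - l1_trunc n x).
      rewrite l1_truncB !opprB addrACA [in RHS]addrACA.
      by congr (_ + _); rewrite addrC.
    rewrite (le_trans (ler_normB _ _))//.
    by rewrite [leRHS]addrC lerD ?l1_norm_tail_le.
  have gA : gamma n * `|A (S N - x)| <= 1.
    have AN : `|A (S N - x)| <= (1 + `|gamma n|)^-1.
      by rewrite linearB /= Ax distrC (le_trans (wA N)).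
    rewrite (le_trans (ler_wpM2r (normr_ge0 _) (ler_norm (gamma n))))//.
    rewrite (le_trans (ler_wpM2l (normr_ge0 (gamma n)) AN))//.
    by rewrite ler_pdivrMr ?ltr_pwDl// mul1r lerDr.
  have := ler_wpM2l mu0 tl; have := l1_psumD n (S N - x) x.
  rewrite subrK; have := l1_psum_le n x; have := l1_norm_tail n (S N); lra.
have [N NP] : exists N, mu * (`|x| + 1) + `|x| + 2 < N%:R :> R.
  by eexists; exact: (truncnS_gt).
by have := le_trans (SN N) (Sbd N); rewrite leNgt NP.
Qed.

End BoundedBelow.

(** * Convergence rates *)

(* Dividing [r^p <= d^p + p K d^(p-1) (r + d)] by [r d^(p-1)] when [r >= d]. *)
Lemma powR_linear_bound (R : realType) (p K d r : R) :
  1 < p -> 0 <= K -> 0 < d -> 0 <= r ->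
  r `^ p <= d `^ p + p * K * d `^ (p - 1) * (r + d) ->
  r <= (1 + 2 * p * K) `^ (p - 1)^-1 * d.
Proof.
move=> p1 K0 d0 r0 h.
have pK : 0 <= p * K by rewrite mulr_ge0//; lra.
have B1 : 1 <= 1 + 2 * p * K by rewrite -mulrA; lra.
have p10 : 0 < p - 1 by lra.
(* For [r <= d] it suffices that the constant is at least 1. *)
have [rd|dr] := leP r d.
  rewrite (le_trans rd)// (ler_peMl (ltW d0))//.
  by rewrite -[leLHS](powRr0 (1 + 2 * p * K)) ler_powR// invr_ge0 ltW.
have rgt0 : 0 < r by exact: lt_trans dr.
have pE (s : R) : 0 < s -> s `^ p = s `^ (p - 1) * s.
  move=> s0; rewrite -{3}(powRr1 (ltW s0)) -powRD ?subrK//.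
  by rewrite (gt_eqF s0) implybT.
have D0 : 0 <= d `^ (p - 1) by exact: powR_ge0.
have : r `^ (p - 1) <= (1 + 2 * p * K) * d `^ (p - 1).
  rewrite -(ler_pM2r rgt0) -pE// (le_trans h)// (pE d)//.
  set D := d `^ _ in D0 *.
  have h1 : D * d <= D * r by rewrite ler_wpM2l// ltW.
  have h2 : p * K * (D * d) <= p * K * (D * r) by rewrite ler_wpM2l.
  lra.
have pV : 0 <= (p - 1)^-1 by rewrite invr_ge0 ltW.
move/(ge0_ler_powR pV); rewrite !nnegrE powR_ge0 mulr_ge0//; last lra.
move=> /(_ isT isT); rewrite powRM//; last lra.
by rewrite -!powRrM mulfV ?gt_eqF// !powRr1// ltW.
Qed.

(** Comparing the functional at [x] and [u] leaves the penalty difference [alpha * (|u| - |x|)]. The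
    reverse triangle inequality turns it into the error, which the lower bound converts back into
    the residual. *)
Lemma minimizer_residual (R : realType) (Y : normedModType R)
    (A : bop (l1 R) Y) (p alpha d : R) (yd : Y) (x u : l1 R) :
  1 < p -> 0 <= alpha -> `|A u - yd| <= d -> is_minimizer A p alpha yd x ->
  `|A x - yd| `^ p <= d `^ p + p * (alpha * `|x - u|).
Proof.
move=> p1 a0 ud /(_ u); rewrite /tikhonov => xu; have p0 : 0 < p by lra.
have udp : `|A u - yd| `^ p <= d `^ p.
  apply: (ge0_ler_powR (ltW p0)) => //; rewrite nnegrE//.
  exact: le_trans (normr_ge0 _) ud.
rewrite -(ler_pM2l (_ : 0 < p^-1)) ?invr_gt0// mulrDr mulKf ?gt_eqF//.
have pV0 : 0 <= p^-1 by rewrite invr_ge0 ltW.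
have := ler_wpM2l pV0 udp.
have := lerB_dist u x; rewrite distrC => /(ler_wpM2l a0).
rewrite mulrBr; lra.
Qed.

Theorem proposition6p1 (R : realType) (Z : completeNormedModType R)
  (hZ : separable_space Z)
  (A : bop (l1 R) (dual Z)) (A_inj : injective A)
  (A_wstar : wstar_continuous A)
  (mu : R) (hmu : 0 <= mu < 1) (gamma : nat -> R)
  (hA : forall (n : nat) (xi : nat -> R), (1 <= n)%N -> bounded_fun xi ->
     (forall k, (k < n)%N -> -1 <= xi k <= 1) ->
     (forall k, (n <= k)%N -> xi k = 0) ->
     exists eta : dual (dual Z),
       [/\ seq_proj n (dual_l1_seq (adjoint A eta)) = xi,
           (forall k, (n <= k)%N ->
              `|(dual_l1_seq (adjoint A eta)
                 - seq_proj n (dual_l1_seq (adjoint A eta))) k| <= mu)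
         & `|eta| <= gamma n])
  (A_closed : range A = closure (range A))
  (p : R) (hp : 1 < p) (xdag : l1 R) (y : dual Z) (hy : y = A xdag) :
  (forall alpha : R -> R, a_priori_choice p alpha ->
     exists C dbar : R, 0 < C /\ 0 < dbar /\
       forall (delta : R) (yd : dual Z), 0 < delta <= dbar ->
         `|y - yd| <= delta ->
         forall x : l1 R, is_minimizer A p (alpha delta) yd x ->
           `|x - xdag| <= C * delta) /\
  (forall tau q alpha0 : R, 1 < tau -> 0 < q < 1 -> 0 < alpha0 ->
     exists C dbar : R, 0 < C /\ 0 < dbar /\
       forall (delta : R) (yd : dual Z), 0 < delta <= dbar ->
         `|y - yd| <= delta ->
         forall (alpha : R) (x : l1 R),
           SDP_choice A p tau q alpha0 delta yd alpha x ->
           `|x - xdag| <= C * delta).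
Proof.
have /andP[mu0 _] := hmu; have p0 : 0 < p by lra.
have [c c0 cA] : exists2 c : R, 0 < c & forall x, `|x| <= c * `|A x|.
  apply: (l1_bounded_below mu0 A_closed) => n x n1.
  by apply: l1_psum_source => // xi; exact: hA.
have err (d : R) yd x : `|y - yd| <= d ->
    `|x - xdag| <= c * (`|A x - yd| + d).
  move=> hd; apply: le_trans (cA _) _.
  rewrite (ler_wpM2l (ltW c0))// linearB /= -hy.
  by apply: le_trans (ler_distD yd _ _) _; rewrite lerD2l distrC.
split=> [alpha [alpha0 [c1 [c2 [c10 [c12 ac]]]]]|tau q a0 tau1 _ _].
  have c20 : 0 < c2 by exact: lt_le_trans c12.
  have [d0 /= d00 dP] := ac.
  (* The constant of [powR_linear_bound] for [K = c2 * c]: [c2] comes from the parameter choice, [c]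
     from the lower bound. *)
  pose B := (1 + 2 * p * (c2 * c)) `^ (p - 1)^-1.
  (* Halving [d0] places every admissible [delta] strictly inside the ball where the bounds on
     [alpha] hold. *)
  exists (c * (B + 1)), (d0 / 2); split.
    by rewrite mulr_gt0 ?ltr_wpDl ?powR_ge0.
  split; first by rewrite divr_gt0.
  move=> d yd /andP[dgt0 dle] hd x xmin.
  have /andP[_ ale] : c1 * d `^ (p - 1) <= alpha d <= c2 * d `^ (p - 1).
    by apply: dP => //=; rewrite sub0r normrN gtr0_norm//; lra.
  have agt0 := alpha0 _ dgt0.
  apply: le_trans (err _ _ x hd) _; rewrite -mulrA (ler_wpM2l (ltW c0))//.
  rewrite mulrDl mul1r lerD2r.
  apply: powR_linear_bound => //; first by rewrite ltW// mulr_gt0.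
  have hd' : `|A xdag - yd| <= d by rewrite -hy.
  apply: le_trans (minimizer_residual hp (ltW agt0) hd' xmin) _.
  rewrite lerD2l -!mulrA (ler_wpM2l (ltW p0))//.
  rewrite [leRHS](_ : _ = c2 * d `^ (p - 1) * (c * (`|A x - yd| + d))).
    by apply: ler_pM ale (err _ _ x hd); first exact: ltW.
  ring.
(* The residual is at most [tau * delta] by the choice of the parameter, so [err] gives the rate for
   every [delta]; the threshold 1 is arbitrary. *)
exists (c * (tau + 1)), 1; split; first by rewrite mulr_gt0//; lra.
split=> // d yd _ hd alpha x [_ [_ [_ [_ [Ax _]]]]].
apply: le_trans (err _ _ x hd) _; rewrite -mulrA (ler_wpM2l (ltW c0))//.
by rewrite mulrDl mul1r lerD2r.
Qed.
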